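(* Let $\sigma_1,\dots,\sigma_\ell\in\{0,1\}$ and suppose \[\tilde F_{\sigma_\ell}\circ\cdots\circ\tilde F_{\sigma_1}((n_1,n_2)\times[k_1,k_2])=(\bar n_1,\bar n_2)\times[\bar k_1,\bar k_2].\] Then \[\tilde F_{\sigma_1}\circ\cdots\circ\tilde F_{\sigma_\ell}\big((\bar k_1+\bar k_2,\bar k_1)\times[\bar n_2,\bar n_1-\bar n_2]\big)=(k_1+k_2,k_1)\times[n_2,n_1-n_2].\]
   Context: $(a_1,a_2)\times[c_1,c_2]$ denotes the partition with $c_1$ parts $a_1$ and $c_2$ parts $a_2$; its conjugate partition is $(c_1+c_2,c_1)\times[a_2,a_1-a_2]$. The extended Farey maps are $\tilde F_0((a_1,a_2)\times[c_1,c_2])=(a_2,a_1-a_2)\times[c_1+c_2,c_1]$ (applicable when $a_2\ge a_1-a_2$) and $\tilde F_1((a_1,a_2)\times[c_1,c_2])=(a_1-a_2,a_2)\times[c_1,c_1+c_2]$ (applicable when $a_1-a_2\ge a_2$). *)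

(* Defs.v *)
From mathcomp Require Import all_boot.

Set Implicit Arguments.
Unset Strict Implicit.
Unset Printing Implicit Defensive.

(* [TwoPart a1 a2 c1 c2] is the expression (a1, a2) x [c1, c2], meant for
   a2 <= a1.  The Farey maps are defined on such expressions and not on the
   partitions they denote: the expression is not determined by the partition
   when a1 = a2, when a2 = 0 or when a multiplicity vanishes, and the maps
   and the conjugation can lead to these degenerate cases. *)
Record twopart := TwoPart { part1 : nat; part2 : nat; mult1 : nat; mult2 : nat }.

(* Zero "parts" are dropped, so that this is a partition for all values. *)
Definition parts (p : twopart) : seq nat :=
  [seq x <- nseq (mult1 p) (part1 p) ++ nseq (mult2 p) (part2 p) | 0 < x].

(* [farey false] is F~_0 and [farey true] is F~_1; the value is [None] where the
   map is not applicable.  Both are applicable when a1 = 2 * a2.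
   The subtraction a1 - a2 is not truncated, as a2 <= a1 is preserved. *)
Definition farey (s : bool) (p : twopart) : option twopart :=
  let: TwoPart a1 a2 c1 c2 := p in
  if s then
    if a2 <= a1 - a2 then Some (TwoPart (a1 - a2) a2 c1 (c1 + c2)) else None
  else
    if a1 - a2 <= a2 then Some (TwoPart a2 (a1 - a2) (c1 + c2) c1) else None.

(* farey_comp [:: s1; ...; sl] is the composition of partial maps
   F~_s1 o ... o F~_sl, in which F~_sl is applied first. *)
Definition farey_comp (s : seq bool) : twopart -> option twopart :=
  foldr (fun b g => pcomp (farey b) g) Some s.

(* Conjugation of partitions, given as weakly decreasing lists; see
   [parts_conjugate] for its effect on (a1, a2) x [c1, c2]. *)
Definition conjugate (l : seq nat) : seq nat :=
  [seq count (ltn i) l | i <- iota 0 (head 0 l)].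

Lemma farey_ordered s p q :
  part2 p <= part1 p -> farey s p = Some q -> part2 q <= part1 q.
Proof. by case: p s => a1 a2 c1 c2 [] /= _; case: ifP => // le [<-]. Qed.

Lemma sumn_parts p :
  sumn (parts p) = part1 p * mult1 p + part2 p * mult2 p.
Proof.
rewrite /parts sumnE big_filter.
have -> : \sum_(i <- nseq (mult1 p) (part1 p) ++ nseq (mult2 p) (part2 p) | 0 < i) i
  = \sum_(i <- nseq (mult1 p) (part1 p) ++ nseq (mult2 p) (part2 p)) i.
  by rewrite [RHS](bigID (ltn 0)) /= [X in _ = _ + X]big1 ?addn0 // => -[].
by rewrite -sumnE sumn_cat !sumn_nseq.
Qed.

Lemma farey_sumn s p q : part2 p <= part1 p -> farey s p = Some q ->
  sumn (parts q) = sumn (parts p).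
Proof.
case: p s => a1 a2 c1 c2 [] /= le21; case: ifP => // _ [<-];
  rewrite !sumn_parts /= -[a1 in RHS](subnK le21) mulnDr [in RHS]mulnDl.
- by rewrite addnA.
- by rewrite addnC addnA.
Qed.

Lemma count_parts p i : count (ltn i) (parts p) =
  (i < part1 p) * mult1 p + (i < part2 p) * mult2 p.
Proof.
rewrite /parts count_filter (@eq_count _ _ (ltn i)); last first.
  by move=> x /=; apply: andb_idr; apply: leq_ltn_trans.
by rewrite count_cat !count_nseq.
Qed.

Lemma parts_conjugate a1 a2 c1 c2 : a2 <= a1 ->
  parts (TwoPart (c1 + c2) c1 a2 (a1 - a2)) =
  conjugate (parts (TwoPart a1 a2 c1 c2)).
Proof.
move=> le21; rewrite /conjugate (eq_map (count_parts _)) /=.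
have low : [seq (i < a1) * c1 + (i < a2) * c2 | i <- iota 0 a2] =
           nseq a2 (c1 + c2).
  rewrite -[X in nseq X](size_iota 0)
    -(size_map (fun i => (i < a1) * c1 + (i < a2) * c2)).
  apply/all_pred1P/allP=> _ /mapP[i + ->]; rewrite mem_iota /= add0n => lti.
  by rewrite lti (leq_trans lti le21) !mul1n.
have high : [seq (i < a1) * c1 + (i < a2) * c2 | i <- iota a2 (a1 - a2)] =
            nseq (a1 - a2) c1.
  rewrite -[X in nseq X](size_iota a2)
    -(size_map (fun i => (i < a1) * c1 + (i < a2) * c2)).
  apply/all_pred1P/allP=> _ /mapP[i + ->].
  rewrite mem_iota subnKC // => /andP[lei lti].
  by rewrite lti ltnNge lei mul1n addn0 /=.
rewrite /parts /= !filter_cat !filter_nseq.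
case: c1 low high => [|c1] low high.
  case: c2 low high => [|c2] low high; first by rewrite !muln0.
  rewrite !mul0n !muln0 !mul1n cats0 /=.
  by case: a2 le21 low {high} => [|a2] le21 low.
rewrite !mul1n; case: a1 le21 low high => [|a1] le21 low high.
  by case: a2 le21 {low high} => //; rewrite /= !mul0n.
by rewrite mul1n [head _ _]/= -[X in iota 0 X](subnKC le21) iotaD map_cat low
            add0n high.
Qed.

(* Main.v *)
Require Import Defs.
From mathcomp Require Import all_boot.

(** Conjugation reverses each Farey map: F~_s p = q implies
    F~_s (conj q) = conj p. Induction on the length reverses the composition. *)

(** [farey s] subtracts among the parts and adds among the multiplicities. Conjugation exchanges
    these roles, so the same map undoes itself there ([farey_conj]), and the last map applied is the
    first to be undone ([farey_comp_conj]). *)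

Definition conj_twopart (p : twopart) : twopart :=
  let: TwoPart a1 a2 c1 c2 := p in TwoPart (c1 + c2) c1 a2 (a1 - a2).

Lemma farey_conj s p q : part2 p <= part1 p -> farey s p = Some q ->
  farey s (conj_twopart q) = Some (conj_twopart p).
Proof.
(* On the conjugate side the applicability test becomes [c1 <= c1 + c2]; the original test [le] lets
   the sum restore the subtracted part. *)
by case: p s => a1 a2 c1 c2 [] /= le21; case: ifP => // le [<-] /=;
  rewrite addKn leq_addr subnKC.
Qed.

(** Peels off the map applied first, whereas [farey_comp] unfolds from the map applied last. *)
Lemma farey_comp_rcons s b p :
  farey_comp (rcons s b) p = obind (farey_comp s) (farey b p).
Proof.
elim: s => [|c s IHs] /=; first by rewrite /pcomp /=; case: (farey b p).
by rewrite /pcomp IHs; case: (farey b p).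
Qed.

Lemma farey_comp_conj s p r : part2 p <= part1 p ->
  farey_comp (rev s) p = Some r ->
  farey_comp s (conj_twopart r) = Some (conj_twopart p).
Proof.
elim: s p => [|b s IHs] p le_p; first by case=> ->.
rewrite rev_cons farey_comp_rcons; case Fp: (farey b p) => [q|] //= Fq.
by rewrite /pcomp (IHs q (farey_ordered le_p Fp) Fq) /= (farey_conj _ _ _ le_p Fp).
Qed.

Theorem theorem4p17 (sigma : seq bool)
    (n1 n2 k1 k2 nbar1 nbar2 kbar1 kbar2 : nat) (le_n : n2 <= n1) :
  farey_comp (rev sigma) (TwoPart n1 n2 k1 k2)
    = Some (TwoPart nbar1 nbar2 kbar1 kbar2) ->
  farey_comp sigma (TwoPart (kbar1 + kbar2) kbar1 nbar2 (nbar1 - nbar2))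
    = Some (TwoPart (k1 + k2) k1 n2 (n1 - n2)).
Proof. exact: (farey_comp_conj sigma (TwoPart n1 n2 k1 k2) _ le_n). Qed.
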